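(* Let $\nu>1/2$, $a=\min\{\frac12,\nu-\frac12\}$ and $0<\lambda<a$. Then there exists a value $\mathcal B_\nu^{(K)}(\lambda)>0$ such that $$\mathcal U_\nu^{(K)}(\lambda,x)=\frac1x\left(\nu+\tfrac12+\lambda+\sqrt{\mathcal B_\nu^{(K)}(\lambda)+x^2}\right)$$ satisfies $$h_\nu(x)=\frac{K_{\nu+1}(x)}{K_\nu(x)}\le \mathcal U_\nu^{(K)}(\lambda,x),\qquad x>0,$$ where, for fixed $\nu$ and $\lambda$, the equality holds at one and only one value of the variable $x_*=x_\nu^{(K)}(\lambda)>0$, where $h_\nu'(x_* )=\mathcal U_\nu^{(K)\prime}(\lambda,x_* )$. As functions of $\lambda\in(0,a)$, both $\mathcal B_\nu^{(K)}(\lambda)$ and $x_\nu^{(K)}(\lambda)$ are decreasing, and the following limits hold for $\nu>1/2$: $$\lim_{\lambda\to0}\mathcal B_\nu^{(K)}(\lambda)=\nu^2-\tfrac14,\qquad \lim_{\lambda\to a}\mathcal B_\nu^{(K)}(\lambda)=\Theta(\nu-1)(\nu-1)^2,$$ $$\lim_{\lambda\to0}x_\nu^{(K)}(\lambda)=+\infty,\qquad \lim_{\lambda\to a}x_\nu^{(K)}(\lambda)=0,$$ with $\Theta(x)=1$ if $x\ge0$ and $\Theta(x)=0$ if $x<0$.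
   Context: $K_\nu$ denotes the modified Bessel function of the second kind of real order $\nu$. Primes denote derivatives with respect to $x$. *)

(* Defs.v *)
From mathcomp Require Import all_boot all_order all_algebra.
From mathcomp Require Import all_classical all_reals all_analysis.
Import Order.TTheory GRing.Theory Num.Theory.
Import numFieldNormedType.Exports.

Set Implicit Arguments.
Unset Strict Implicit.
Unset Printing Implicit Defensive.

Local Open Scope classical_set_scope.
Local Open Scope ring_scope.

Definition cosh (R : realType) (t : R) : R := (expR t + expR (- t)) / 2.

(* The modified Bessel function of the second kind, given by its standard
   integral representation (DLMF 10.32.9)
     K_nu(x) = int_0^oo exp(- x cosh t) cosh(nu t) dt,
   valid for every real nu and every x > 0; unlike
   (pi / 2) (I_{-nu} - I_nu) / sin(nu pi) it needs no limit at integer nu.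
   The value for x <= 0, where the integral diverges, is irrelevant. *)
Definition besselK (R : realType) (nu x : R) : R :=
  \int[@lebesgue_measure R]_(t in `[0, +oo[)
    (expR (- x * cosh t) * cosh (nu * t)).

Definition hK (R : realType) (nu x : R) : R :=
  besselK (nu + 1) x / besselK nu x.

(* The bound U_nu(lambda, x), with the value b of B_nu(lambda) as a parameter. *)
Definition UK (R : realType) (nu b lambda x : R) : R :=
  x^-1 * (nu + 2^-1 + lambda + Num.sqrt (b + x ^+ 2)).

Definition Theta (R : realType) (x : R) : R := if 0 <= x then 1 else 0.

(* Main.v *)
Require Import Defs.
From mathcomp Require Import all_boot all_order all_algebra.
From mathcomp Require Import all_classical all_reals all_analysis.
From mathcomp Require Import measurable_realfun.
From mathcomp Require Import ring lra.
Import Order.TTheory GRing.Theory Num.Theory.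
Import numFieldNormedType.Exports.
Local Open Scope classical_set_scope.
Local Open Scope ring_scope.
Set Implicit Arguments.
Unset Strict Implicit.
Unset Printing Implicit Defensive.

(** Write h = K_(nu+1) / K_nu and y = x h - nu = - x K_nu' / K_nu.  The
    recurrences for K give the Riccati equation x y' = P with
    P = y^2 - x^2 - nu^2.  With w = y - 1/2 - lambda the inequality
    h <= U is w <= sqrt (B + x^2), and since w > 0 it says that the level
    F = w^2 - x^2 stays below B.  Hence the best B is the maximum of F over
    x > 0, and the theorem amounts to F having exactly one critical point
    ([critK]), where it is maximal.

    The Riccati equation gives x F' = 2 G with G = w P - x^2.  The derivative
    of G itself has no definite sign, but G multiplied by the positive weight
    K_nu^2 x^(2 lambda - 1) / (1 + w) has a derivative proportional to - N,
    where N = nu^2 - (1/2 + lambda)^2 + 2 lambda - 2 lambda (1 + w)^2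
    ([is_derive_weighted]).  Since w increases, N decreases, so the weighted G
    first decreases and then increases; it tends to 0 at infinity because K
    decays exponentially, so once G has reached 0 it stays negative
    ([levelslopeK_no_return]).  As G is negative for large x, and
    positive for some small x ([levelslopeK_gt0_near0], from the limit of the
    logarithmic derivative of K_(nu-1) at 0), it changes sign exactly once.
    At the two ends of the range of lambda the sign of N is constant: for
    lambda = 0, G is positive everywhere, and for lambda = a it is negative
    everywhere.

    The remaining claims follow by comparison.  F and G decrease in lambda, so
    B and the contact point do too.  The sign of G at the ends forces the
    contact point to infinity as lambda tends to 0 and to 0 as lambda tends to
    a.  For lambda = 0 one gets the two bounds
    (nu^2 - 1/4) w / (1 + w) < F < nu^2 - 1/4, whence the first limit of B;
    and (nu - 1/2 - lambda)^2 <= B <= w^2, with w taken at the contact point,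
    gives the second.

    Only a few facts about K are used: positivity, monotonicity in the
    absolute value of the order, exponential decay, the three-term recurrence
    and the formula for K'.  They are derived from the integral
    representation, and the analysis above is carried out for any family K
    that has them. *)

(** * Derivatives of explicit functions of one variable *)

Section Calculus.
Context {R : realType}.
Implicit Types (f g : R -> R) (x a b d : R).

Lemma is_derive_congr [f g : R -> R] [x a b : R] :
  is_derive x 1 f a -> f =1 g -> a = b -> is_derive x 1 g b.
Proof. by move=> h /funext <- <-. Qed.

Lemma is_derive_add [f g : R -> R] [x a b : R] : is_derive x 1 f a -> is_derive x 1 g b ->
  is_derive x 1 (fun z => f z + g z) (a + b).
Proof. by move=> hf hg; exact: is_deriveD. Qed.

Lemma is_derive_opp [f : R -> R] [x a : R] : is_derive x 1 f a ->
  is_derive x 1 (fun z => - f z) (- a).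
Proof. by move=> hf; exact: is_deriveN. Qed.

Lemma is_derive_mul [f g : R -> R] [x a b : R] : is_derive x 1 f a -> is_derive x 1 g b ->
  is_derive x 1 (fun z => f z * g z) (a * g x + f x * b).
Proof.
move=> hf hg; apply: (is_derive_congr (is_deriveM hf hg)) => //.
by rewrite /GRing.scale /= addrC mulrC.
Qed.

Lemma is_derive_inv [f : R -> R] [x a : R] : f x != 0 -> is_derive x 1 f a ->
  is_derive x 1 (fun z => (f z)^-1) (- a / f x ^+ 2).
Proof.
move=> fx hf; apply: (is_derive_congr (is_deriveV fx hf)) => //.
by rewrite /GRing.scale /= mulNr mulrC mulNr.
Qed.

Lemma is_derive_exp2 [f : R -> R] [x a : R] : is_derive x 1 f a ->
  is_derive x 1 (fun z => f z ^+ 2) (2 * f x * a).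
Proof.
move=> hf; apply: (is_derive_congr (is_derive_mul hf hf)) => //; ring.
Qed.

Lemma is_derive_exp [f : R -> R] [x a : R] : is_derive x 1 f a ->
  is_derive x 1 (fun z => expR (f z)) (expR (f x) * a).
Proof. by move=> hf; exact: (is_derive1_comp (is_derive_expR (f x)) hf). Qed.

Lemma is_derive_powR [x : R] (p : R) : 0 < x ->
  is_derive x 1 (fun z => z `^ p) (p * (x `^ p) / x).
Proof.
move=> x0; have xi : x \in `]0, +oo[ by rewrite in_itv /= andbT.
apply: DeriveDef; first exact: derivable_powR.
have xn : (p == 1) ==> (x != 0) by rewrite (gt_eqF x0) implybT.
by rewrite -derive1E powR_derive1 //= powRB // powRr1 ?(ltW x0) // mulrA.
Qed.

Lemma is_derive_var (x : R) : is_derive x 1 (fun z => z) (1 : R).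
Proof. exact: is_derive_id. Qed.

Lemma is_derive_const (c x : R) : is_derive x 1 (fun=> c) (0 : R).
Proof. exact: is_derive_cst. Qed.

End Calculus.

(** Computes a derivative by the rules above.  Type class resolution is
    bypassed because its instances express derivatives with the scaling of a
    module, which [ring] and [field] do not see through. *)
Ltac derive_step :=
  first [ eassumption | exact: is_derive_var | exact: is_derive_const
        | notypeclasses refine (is_derive_add _ _) | notypeclasses refine (is_derive_opp _)
        | notypeclasses refine (is_derive_exp2 _)
        | notypeclasses refine (is_derive_mul _ _)
        | notypeclasses refine (is_derive_exp _)
        | notypeclasses refine (is_derive_inv _ _) ].
Ltac derive := notypeclasses refine (is_derive_eq _ _); [ repeat derive_step | cbv beta ].

(** * Monotonicity, decay and integrals over the half-line *)
Section Monotonicity.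
Context {R : realType}.
Implicit Types (f g : R -> R) (x a b d : R).
Notation mu := (@lebesgue_measure R).

Lemma derive_gt0_lt [f df : R -> R] [a b : R] : a < b ->
  (forall z, a <= z <= b -> is_derive z 1 f (df z)) ->
  (forall z, a < z < b -> 0 < df z) -> f a < f b.
Proof.
move=> ab hf hp.
have hd z : z \in `]a, b[ -> is_derive z 1 f (df z).
  by rewrite in_itv /= => /andP[az zb]; apply: hf; rewrite !ltW.
have hc : {within `[a, b], continuous f}.
  apply: derivable_within_continuous => z; rewrite in_itv /= => zab.
  by have [] := hf z zab.
have [c cab fab] := MVT ab hd hc.
rewrite -subr_gt0 fab mulr_gt0 ?subr_gt0 //.
by apply: hp; move: cab; rewrite in_itv.
Qed.

Lemma derive_lt0_gt [f df : R -> R] [a b : R] : a < b ->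
  (forall z, a <= z <= b -> is_derive z 1 f (df z)) ->
  (forall z, a < z < b -> df z < 0) -> f b < f a.
Proof.
move=> ab hf hn; rewrite -ltrN2.
apply: (@derive_gt0_lt (fun z => - f z) (fun z => - df z)) => // z hz.
  by apply: is_derive_opp; exact: hf.
by rewrite oppr_gt0 hn.
Qed.

Lemma derive_ge0_le [f df : R -> R] [a b : R] : a <= b ->
  (forall z, a <= z <= b -> is_derive z 1 f (df z)) ->
  (forall z, a < z < b -> 0 <= df z) -> f a <= f b.
Proof.
rewrite le_eqVlt => /predU1P[-> //|ab] hf hp.
have hd z : z \in `]a, b[ -> is_derive z 1 f (df z).
  by rewrite in_itv /= => /andP[az zb]; apply: hf; rewrite !ltW.
have hc : {within `[a, b], continuous f}.
  apply: derivable_within_continuous => z; rewrite in_itv /= => zab.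
  by have [] := hf z zab.
have [c cab fab] := MVT ab hd hc.
rewrite -subr_ge0 fab mulr_ge0 ?subr_ge0 ?(ltW ab) //.
by apply: hp; move: cab; rewrite in_itv.
Qed.

(** A concrete form of convergence to 0 at infinity: a bound by a multiple of
    1 / x is all that is ever needed, and it is stable under the operations
    used below. *)
Definition vanishing (f : R -> R) := exists C : R, forall x, 1 <= x -> `|f x| <= C / x.

(** A function that decreases towards the limit 0 is positive; this is how
    every sign below is read off from the sign of a derivative. *)
Lemma decreasing_vanishing_gt0 [f df : R -> R] [x0 : R] :
  (forall x, x0 <= x -> is_derive x 1 f (df x)) ->
  (forall x, x0 < x -> df x < 0) -> vanishing f -> 0 < f x0.
Proof.
move=> hf hd [C hC]; rewrite ltNge; apply/negP => f0.
have lt_f x y : x0 <= x -> x < y -> f y < f x.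
  move=> xx xy; apply: (@derive_lt0_gt f df) => // z /andP[xz zy].
    by apply: hf; lra.
  by apply: hd; lra.
have f1 : f (x0 + 1) < 0 by apply: (lt_le_trans _ f0); apply: lt_f; lra.
set e := - f (x0 + 1); have e0 : 0 < e by rewrite oppr_gt0.
pose x := `|C| / e + `|x0| + 3.
have Ce : 0 <= `|C| / e by rewrite divr_ge0 // ltW.
have xa : x0 <= `|x0| by exact: ler_norm.
have xb : 0 <= `|x0| by [].
have x1 : 1 <= x by rewrite /x; lra.
have x2 : x0 + 1 < x by rewrite /x; lra.
have := lt_f (x0 + 1) x; rewrite lerDl ler01 x2 => /(_ isT isT) fx.
have h := hC x x1.
have h1 : e < `|f x| by rewrite /e ltr0_norm ?ltrN2 // (lt_trans fx f1).
have h2 : e < C / x by exact: lt_le_trans h1 h.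
move: h2; rewrite ltr_pdivlMr; last lra.
rewrite /x 2!mulrDr mulrCA divff ?gt_eqF // mulr1.
have := ler_norm C.
have : 0 <= e * `|x0| by rewrite mulr_ge0 // ltW.
lra.
Qed.

Lemma increasing_vanishing_lt0 [f df : R -> R] [x0 : R] :
  (forall x, x0 <= x -> is_derive x 1 f (df x)) ->
  (forall x, x0 < x -> 0 < df x) -> vanishing f -> f x0 < 0.
Proof.
move=> hf hd [C hC]; rewrite -oppr_gt0.
apply: (@decreasing_vanishing_gt0 (fun z => - f z) (fun z => - df z)).
- by move=> x x0x; apply: is_derive_opp; exact: hf.
- by move=> x x0x; rewrite oppr_lt0 hd.
- by exists C => x x1; rewrite normrN hC.
Qed.

Let cont_derive (f df : R -> R) : (forall t : R, is_derive t 1 f (df t)) -> continuous f.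
Proof.
move=> h x; apply: differentiable_continuous; apply/derivable1_diffP.
by have [] := h x.
Qed.

Lemma Rintegral_FTCy [f F : R -> R] [l : R] :
  (forall t : R, is_derive t 1 F (f t)) -> continuous f -> (forall t, 0 <= t -> 0 <= f t) ->
  F t @[t --> +oo] --> l ->
  \int[mu]_(t in `[0, +oo[) f t = l - F 0.
Proof.
move=> hF cf f0 Fl; apply: Rintegral_ge0_continuous_FTC2y.
- exact: f0.
- exact: continuous_subspaceT.
- exact: Fl.
- by move=> x _; have [] := hF x.
- by apply: cvg_at_right_filter; exact: (@cont_derive F f hF 0).
- by move=> x _; rewrite derive1E; have [] := hF x.
Qed.

Lemma integrable_dominated [f : R -> R] [C : R] : continuous f ->
  (forall t, 0 <= t -> `|f t| <= C * expR (- t)) ->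
  mu.-integrable `[0, +oo[ (EFin \o f).
Proof.
move=> cf hf.
have iexp : mu.-integrable `[0, +oo[ (EFin \o (fun t : R => expR (- t))).
  have := @integrable_exponential_pdf R 1 ltr01.
  rewrite /exponential_pdf -restrict_EFin -integrable_mkcond //.
  by apply: eq_integrable => // x _; rewrite /= mul1r mulN1r.
have iCexp : mu.-integrable `[0, +oo[ (EFin \o (fun t : R => C * expR (- t))).
  by have /= := integrableZl _ C iexp; apply.
apply: (le_integrable _ _ _ iCexp) => //.
- apply/measurable_EFinP; apply: measurable_funTS.
  exact: continuous_measurable_fun.
- move=> x; rewrite /= in_itv /= andbT => x0; rewrite lee_fin.
  exact: le_trans (hf x x0) (ler_norm _).
Qed.

(** For nonnegative integrands the fundamental theorem of calculus on the
    half-line comes from monotone convergence.  An integrand dominated by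
    C e^(-t) becomes nonnegative after adding C e^(-t), whose own integral is
    known. *)
Lemma Rintegral_dominated_FTCy [f F : R -> R] [C l : R] :
  (forall t : R, is_derive t 1 F (f t)) -> continuous f ->
  (forall t, 0 <= t -> `|f t| <= C * expR (- t)) ->
  F t @[t --> +oo] --> l ->
  \int[mu]_(t in `[0, +oo[) f t = l - F 0.
Proof.
move=> hF cf hf Fl.
have hE (t : R) : is_derive t 1 (fun z : R => - (C * expR (- z))) (C * expR (- t)).
  by derive; ring.
have cE : continuous (fun z : R => C * expR (- z)).
  by apply: (@cont_derive _ (fun t => - (C * expR (- t)))) => t; derive; ring.
have lE : (- (C * expR (- t))) @[t --> +oo] --> (0 : R).
  rewrite -oppr0 -(mulr0 C); apply: cvgN; apply: cvgMl_tmp; exact: cvgr_expR.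
have C0 : 0 <= C.
  by have := hf 0 (lexx 0); rewrite oppr0 expR0 mulr1; exact: le_trans.
have i1 := Rintegral_FTCy hE cE (fun t _ => mulr_ge0 C0 (expR_ge0 _)) lE.
have i2 : \int[mu]_(t in `[0, +oo[) (f t + C * expR (- t)) =
    (l + 0) - (F 0 + - (C * expR (- 0))).
  apply: (@Rintegral_FTCy _ (fun t => F t + - (C * expR (- t)))).
  - by move=> t; apply: cvgD; [exact: cf|exact: cE].
  - by move=> t t0; have := hf t t0; rewrite ler_norml => /andP[+ _]; lra.
  - exact: cvgD.
have if_ := integrable_dominated cf hf.
have iE : mu.-integrable `[0, +oo[ (EFin \o (fun t : R => C * expR (- t))).
  apply: (@integrable_dominated _ C) => // t _.
  by rewrite ger0_norm // mulr_ge0 // expR_ge0.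
move: i2; rewrite RintegralD // i1; lra.
Qed.

End Monotonicity.
(** * Hyperbolic functions *)
Section HyperbolicCosine.
Context {R : realType}.
Implicit Types (s t x k : R).

Definition sinh (t : R) : R := (expR t - expR (- t)) / 2.

Lemma coshN t : cosh (- t) = cosh t.
Proof. by rewrite /cosh opprK addrC. Qed.

Lemma cosh_ge1 t : 1 <= cosh t.
Proof.
rewrite /cosh; have := expR_ge1Dx t; have := expR_ge1Dx (- t); lra.
Qed.

Lemma cosh_gt0 t : 0 < cosh t.
Proof. exact: lt_le_trans ltr01 (cosh_ge1 t). Qed.

Lemma cosh_norm t : cosh `|t| = cosh t.
Proof. by case: (ger0P t) => _ //; rewrite coshN. Qed.

Lemma cosh_le_norm s t : `|s| <= `|t| -> cosh s <= cosh t.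
Proof.
move=> st; rewrite -(cosh_norm s) -(cosh_norm t) /cosh ler_pM2r ?invr_gt0 ?ltr0n //.
set a := `|s|; set b := `|t|.
have ab : expR a <= expR b by rewrite ler_expR.
have p : expR (- (a + b)) <= 1 by rewrite expR_le1 oppr_le0 addr_ge0 ?normr_ge0.
have ea : expR (- a) = expR b * expR (- (a + b)).
  by rewrite -expRD; congr expR; ring.
have eb : expR (- b) = expR a * expR (- (a + b)).
  by rewrite -expRD; congr expR; ring.
rewrite ea eb; nra.
Qed.

Lemma cosh_le_expR t : cosh t <= expR `|t|.
Proof.
rewrite -cosh_norm /cosh.
have : expR (- `|t|) <= expR `|t| by rewrite ler_expR; have := normr_ge0 t; lra.
lra.
Qed.

Lemma norm_sinh_le_cosh t : `|sinh t| <= cosh t.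
Proof.
by rewrite /sinh /cosh ler_norml; have := expR_gt0 t; have := expR_gt0 (- t); lra.
Qed.

Lemma cosh_mul s t : cosh s * cosh t = (cosh (t + s) + cosh (t - s)) / 2.
Proof.
rewrite /cosh !opprD !opprK !expRD; set a := expR s; set b := expR t.
by set c := expR (- s); set d := expR (- t); field.
Qed.

Lemma sinh_mul s t : sinh s * sinh t = (cosh (t + s) - cosh (t - s)) / 2.
Proof.
rewrite /cosh /sinh !opprD !opprK !expRD; set a := expR s; set b := expR t.
by set c := expR (- s); set d := expR (- t); field.
Qed.

Lemma is_derive_cosh [f : R -> R] [x a : R] : is_derive x 1 f a ->
  is_derive x 1 (fun z => cosh (f z)) (sinh (f x) * a).
Proof. by move=> hf; rewrite /cosh; derive; rewrite /sinh; field. Qed.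

Lemma is_derive_sinh [f : R -> R] [x a : R] : is_derive x 1 f a ->
  is_derive x 1 (fun z => sinh (f z)) (cosh (f x) * a).
Proof. by move=> hf; rewrite /sinh; derive; rewrite /cosh; field. Qed.

End HyperbolicCosine.

(** * The integral representation of K *)
Section BesselIntegrals.
Context {R : realType}.
Implicit Types (k x t : R).
Notation mu := (@lebesgue_measure R).

Definition kernelK (k x t : R) : R := expR (- x * cosh t) * cosh (k * t).

Lemma kernelK_gt0 k x t : 0 < kernelK k x t.
Proof. by rewrite mulr_gt0 ?expR_gt0 ?cosh_gt0. Qed.

Lemma kernelK_cosh k x t :
  cosh t * kernelK k x t = (kernelK (k + 1) x t + kernelK (k - 1) x t) / 2.
Proof.
rewrite /kernelK mulrCA cosh_mul !mulrDl !mul1r !mulNr mul1r; ring.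
Qed.

Lemma is_derive_kernelK_order k x t :
  is_derive t 1 (kernelK k x) (expR (- x * cosh t) *
    (k * sinh (k * t) - x * sinh t * cosh (k * t))).
Proof.
have h1 : is_derive t 1 (fun z => cosh z) (sinh t * 1).
  exact: is_derive_cosh (is_derive_var t).
have h2 : is_derive t 1 (fun z => cosh (k * z)) (sinh (k * t) * (0 * t + k * 1)).
  by apply: is_derive_cosh; derive.
by rewrite /kernelK; derive; ring.
Qed.

Lemma continuous_kernelK k x : continuous (kernelK k x).
Proof.
move=> t; apply: differentiable_continuous; apply/derivable1_diffP.
by have [] := is_derive_kernelK_order k x t.
Qed.

(** With u = e^t the kernel is at most u^(N+1) e^(- x u / 2) as soon as
    |k| <= N + 1, and e^z >= z^n / n! beats any power of u. *)
Lemma kernelK_dominated k x : 0 < x ->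
  exists C : R, forall t, 0 <= t -> kernelK k x t <= C * expR (- t).
Proof.
move=> x0; set N := Num.trunc `|k|.
exists ((N.+2)`!%:R * (2 / x) ^+ N.+2) => t t0.
have kN : `|k| <= N.+1%:R by apply/ltW/truncnS_gt.
have ct : cosh (k * t) <= expR t ^+ N.+1.
  rewrite (le_trans (cosh_le_expR _)) // -expRM_natl ler_expR.
  by rewrite normrM (ger0_norm t0); exact: ler_wpM2r.
have xt : x * expR t / 2 <= x * cosh t.
  by rewrite -mulrA ler_pM2l // /cosh; have := expR_gt0 (- t); lra.
have z0 : 0 <= x * expR t / 2.
  by rewrite divr_ge0 // mulr_ge0 ?expR_ge0 // ltW.
have hz := expR_ge1Dxn N.+1 z0.
have f0 : 0 < (N.+2)`!%:R :> R by rewrite ltr0n fact_gt0.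
have hz2 : (x * expR t / 2) ^+ N.+2 <= (N.+2)`!%:R * expR (x * cosh t).
  rewrite -ler_pdivrMl // mulrC.
  have : expR (x * expR t / 2) <= expR (x * cosh t) by rewrite ler_expR.
  lra.
have hu : expR t ^+ N.+2 <= (N.+2)`!%:R * (2 / x) ^+ N.+2 * expR (x * cosh t).
  have -> : expR t ^+ N.+2 = (2 / x) ^+ N.+2 * (x * expR t / 2) ^+ N.+2.
    by rewrite -exprMn; congr (_ ^+ _); field; rewrite gt_eqF.
  rewrite mulrC [leRHS]mulrAC ler_wpM2r //; last by rewrite exprn_ge0 // divr_ge0 // ltW.
rewrite /kernelK mulNr !expRN ler_pdivlMr ?expR_gt0 // -mulrA mulrC.
rewrite ler_pdivrMr ?expR_gt0 //.
by apply: le_trans hu; rewrite exprSr ler_wpM2r ?expR_ge0.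
Qed.

Lemma integrable_kernelK k x : 0 < x -> mu.-integrable `[0, +oo[ (EFin \o kernelK k x).
Proof.
move=> x0; have [C hC] := kernelK_dominated k x0.
apply: (@integrable_dominated _ _ C); first exact: continuous_kernelK.
by move=> t t0; rewrite gtr0_norm ?kernelK_gt0 // hC.
Qed.

Lemma besselKE k x : besselK k x = \int[mu]_(t in `[0, +oo[) kernelK k x t.
Proof. by []. Qed.

Lemma besselK_le_order [k l x : R] : 0 < x -> `|k| <= `|l| -> besselK k x <= besselK l x.
Proof.
move=> x0 kl; apply: le_Rintegral => //; try exact: integrable_kernelK.
move=> t _; rewrite ler_wpM2l ?expR_ge0 // cosh_le_norm // !normrM.
by rewrite ler_wpM2r.
Qed.

(** Since cosh >= 1, raising the argument from 1 to x multiplies the kernel by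
    at most e^(1 - x). *)
Lemma besselK_decay k x : 1 <= x -> besselK k x <= expR (1 - x) * besselK k 1.
Proof.
move=> x1; have x0 : 0 < x by lra.
rewrite !besselKE -RintegralZl //; last exact: integrable_kernelK.
apply: le_Rintegral => //; first exact: integrable_kernelK.
  by have := integrableZl _ (expR (1 - x)) (integrable_kernelK k ltr01); apply.
move=> t _; rewrite /kernelK mulrA ler_wpM2r //; first exact/ltW/cosh_gt0.
rewrite -expRD ler_expR.
have := cosh_ge1 t; nra.
Qed.

Lemma besselK_gt0 k x : 0 < x -> 0 < besselK k x.
Proof.
move=> x0; apply: (@lt_le_trans _ _ (expR (- x * cosh 1))); first exact: expR_gt0.
have i01 : mu.-integrable `[0, 1] (EFin \o kernelK k x).
  apply: (@integrableS _ _ _ mu `[0, +oo[) => //; last exact: integrable_kernelK.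
  by apply: subset_itvl.
apply: (@le_trans _ _ (\int[mu]_(t in `[0, 1]) kernelK k x t)).
  apply: (@le_trans _ _ (\int[mu]_(t in `[0, 1]) expR (- x * cosh 1))).
    by rewrite Rintegral_cst //= lebesgue_measure_itv /= lte_fin ltr01 oppr0 adde0 mulr1.
  apply: le_Rintegral => //.
    apply: continuous_compact_integrable; first exact: segment_compact.
    by apply: continuous_subspaceT => ?; exact: cvg_cst.
  move=> t; rewrite /= in_itv /= => /andP[t0 t1].
  rewrite -[leLHS]mulr1 ler_pM ?expR_ge0 ?cosh_ge1 // ler_expR !mulNr lerN2.
  by rewrite ler_pM2l // cosh_le_norm // !ger0_norm.
rewrite /besselK /Rintegral fine_le //.
- exact: integrable_fin_num.
- by apply: integrable_fin_num => //; exact: integrable_kernelK.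
- apply: ge0_subset_integral => //.
  + by apply: (measurable_int mu); exact: integrable_kernelK.
  + by move=> t _; rewrite lee_fin ltW // kernelK_gt0.
  + exact: subset_itvl.
Qed.

End BesselIntegrals.
(** * Derivative and recurrence of K *)
Section BesselEquations.
Context {R : realType}.
Implicit Types (k x t : R).
Notation mu := (@lebesgue_measure R).

Let integrable_add (f g : R -> R) : mu.-integrable `[0, +oo[ (EFin \o f) ->
  mu.-integrable `[0, +oo[ (EFin \o g) ->
  mu.-integrable `[0, +oo[ (EFin \o (fun t => f t + g t)).
Proof. by move=> hf hg; have := integrableD _ hf hg; apply. Qed.

Lemma integrable_cosh_kernelK k x : 0 < x ->
  mu.-integrable `[0, +oo[ (EFin \o (fun t => cosh t * kernelK k x t)).
Proof.
move=> x0.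
have -> : (fun t => cosh t * kernelK k x t)
    = (fun t => 2^-1 * kernelK (k + 1) x t + 2^-1 * kernelK (k - 1) x t).
  by apply/funext => t; rewrite kernelK_cosh; field.
have h l : mu.-integrable `[0, +oo[ (EFin \o (fun t => 2^-1 * kernelK l x t)).
  by have := integrableZl _ (2^-1) (integrable_kernelK l x0); apply.
exact: integrable_add.
Qed.

Lemma Rintegral_cosh_kernelK k x : 0 < x ->
  \int[mu]_(t in `[0, +oo[) (cosh t * kernelK k x t)
  = (besselK (k + 1) x + besselK (k - 1) x) / 2.
Proof.
move=> x0; rewrite !besselKE -RintegralD //; try exact: integrable_kernelK.
rewrite -RintegralZr //.
  by apply: eq_Rintegral => t _; rewrite kernelK_cosh.
by apply: integrable_add; exact: integrable_kernelK.
Qed.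

(** Differentiation under the integral sign.  On the interval ]x/2, 2x[ the
    derivative of the kernel is dominated by its absolute value at x/2. *)
Lemma is_derive_besselK_mean k x : 0 < x ->
  is_derive x 1 (besselK k) (- ((besselK (k + 1) x + besselK (k - 1) x) / 2)).
Proof.
move=> x0.
pose I := `]x / 2, 2 * x[%classic : set R.
have Ix : I x by rewrite /I /= in_itv /=; lra.
have I0 z : I z -> x / 2 < z by rewrite /I /= in_itv /= => /andP[].
have dk (z t : R) : is_derive z 1 (fun z => kernelK k z t) (- (cosh t * kernelK k z t)).
  by rewrite /kernelK; derive; ring.
have intf z : I z -> mu.-integrable `[0, +oo[ (EFin \o kernelK k z).
  by move=> /I0 Iz; apply: integrable_kernelK; lra.
have derf (z t : R) : I z -> `[0, +oo[%classic t -> derivable (fun z => kernelK k z t) z 1.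
  by move=> _ _; have [] := dk z t.
have dE (z t : R) : partial1of2 (kernelK k) z t = - (cosh t * kernelK k z t).
  by rewrite partial1of2E; have [] := dk z t.
have G0 t : 0 <= cosh t * kernelK k (x / 2) t.
  by rewrite mulr_ge0 // ltW ?cosh_gt0 ?kernelK_gt0.
have iG : mu.-integrable `[0, +oo[ (EFin \o (fun t => cosh t * kernelK k (x / 2) t)).
  by apply: integrable_cosh_kernelK; lra.
have Gub (z t : R) : I z -> `[0, +oo[%classic t ->
    `|partial1of2 (kernelK k) z t| <= cosh t * kernelK k (x / 2) t.
  move=> /I0 Iz _; rewrite dE normrN (gtr0_norm (mulr_gt0 (cosh_gt0 _) (kernelK_gt0 _ _ _))).
  rewrite ler_wpM2l ?(ltW (cosh_gt0 _)) // ler_wpM2r ?(ltW (cosh_gt0 _)) //.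
  by rewrite ler_expR !mulNr lerN2 ler_wpM2r ?(ltW (cosh_gt0 _)) // ltW.
have mD : measurable (`[0, +oo[%classic : set (measurableTypeR R)) by [].
have dK : derivable (besselK k : R -> R) x 1.
  exact: (@derivable_under_integral _ _ _ mu (kernelK k) _ mD x (x / 2) (2 * x)
    Ix intf derf _ G0 iG Gub).
apply: (DeriveDef dK); rewrite -derive1E.
have e : derive1 (besselK k) x = \int[mu]_(t in `[0, +oo[) partial1of2 (kernelK k) x t :=
  (@differentiation_under_integral _ _ _ mu (kernelK k) _ mD x (x / 2) (2 * x)
    Ix intf derf _ G0 iG Gub).
rewrite e.
rewrite -Rintegral_cosh_kernelK // -mulN1r -RintegralZl //; last exact: integrable_cosh_kernelK.
by apply: eq_Rintegral => t _; rewrite dE mulN1r.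
Qed.

(** Integration by parts: the recurrence says that the derivative of
    e^(- x cosh t) sinh (k t) has integral 0. *)
Lemma besselK_recurrence k x : 0 < x ->
  x * (besselK (k + 1) x - besselK (k - 1) x) = 2 * k * besselK k x.
Proof.
move=> x0.
pose F t := expR (- x * cosh t) * sinh (k * t).
pose f t := k * kernelK k x t - x / 2 * (kernelK (k + 1) x t - kernelK (k - 1) x t).
have dF (t : R) : is_derive t 1 F (f t).
  have h1 : is_derive t 1 (fun z => cosh z) (sinh t * 1).
    exact: is_derive_cosh (is_derive_var t).
  have h2 : is_derive t 1 (fun z => sinh (k * z)) (cosh (k * t) * (0 * t + k * 1)).
    by apply: is_derive_sinh; derive.
  rewrite /F; derive.
  have := sinh_mul t (k * t); rewrite /f /kernelK !mulrDl !mul1r mulN1r.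
  set a := cosh (k * t + t); set b := cosh (k * t - t).
  by move=> e; rewrite (_ : a = 2 * (sinh t * sinh (k * t)) + b); [field|rewrite e; field].
have [C1 h1] := kernelK_dominated k x0.
have [C2 h2] := kernelK_dominated (k + 1) x0.
have [C3 h3] := kernelK_dominated (k - 1) x0.
have cf : continuous f.
  by move=> t; apply: cvgB; [|apply: cvgM; [exact: cvg_cst|apply: cvgB]];
    try (apply: cvgM; first exact: cvg_cst); exact: continuous_kernelK.
have fd t : 0 <= t -> `|f t| <= (`|k| * C1 + x / 2 * (C2 + C3)) * expR (- t).
  move=> t0; rewrite /f; apply: le_trans (ler_normB _ _) _.
  rewrite mulrDl; apply: lerD.
    by rewrite normrM (gtr0_norm (kernelK_gt0 _ _ _)) -mulrA ler_wpM2l // h1.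
  rewrite normrM gtr0_norm ?divr_gt0 // -[leRHS]mulrA ler_wpM2l ?divr_ge0 ?(ltW x0) //.
  apply: le_trans (ler_normB _ _) _; rewrite !gtr0_norm ?kernelK_gt0 // mulrDl.
  by rewrite lerD ?h2 ?h3.
have Fl : F t @[t --> +oo] --> (0 : R).
  have E0 : C1 * expR (- t) @[t --> +oo] --> (0 : R).
    by rewrite -(mulr0 C1); apply: cvgMl_tmp; exact: cvgr_expR.
  have E1 : - (C1 * expR (- t)) @[t --> +oo] --> (0 : R).
    by rewrite -oppr0; apply: cvgN.
  apply: (squeeze_cvgr _ E1 E0); near=> t.
  have t0 : 0 <= t by near: t; exact: nbhs_pinfty_ge.
  rewrite -ler_norml (le_trans _ (h1 t t0)) // /F normrM gtr0_norm ?expR_gt0 //.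
  by rewrite ler_wpM2l ?expR_ge0 // norm_sinh_le_cosh.
have := Rintegral_dominated_FTCy dF cf fd Fl.
rewrite /F mulr0 /sinh oppr0 subrr mul0r mulr0 subr0.
have i l : mu.-integrable `[0, +oo[ (EFin \o kernelK l x) by exact: integrable_kernelK.
have ia : mu.-integrable `[0, +oo[ (EFin \o (fun t => k * kernelK k x t)).
  by have := integrableZl _ k (i k); apply.
have id : mu.-integrable `[0, +oo[ (EFin \o (fun t => kernelK (k + 1) x t - kernelK (k - 1) x t)).
  by apply: (@integrableB _ _ _ mu _ _ (EFin \o kernelK (k + 1) x) (EFin \o kernelK (k - 1) x)).
have ib : mu.-integrable `[0, +oo[
    (EFin \o (fun t => x / 2 * (kernelK (k + 1) x t - kernelK (k - 1) x t))).
  by have := integrableZl _ (x / 2) id; apply.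
rewrite /f RintegralB // RintegralZl // RintegralZl // RintegralB // -!besselKE.
move: (besselK k x) (besselK (k + 1) x) (besselK (k - 1) x) => u v w e; lra.
Unshelve. all: end_near. Qed.

End BesselEquations.
(** * The logarithmic derivative of K *)
(** The hypotheses isolate what is used of the Bessel functions.  Keeping K
    abstract also prevents any unfolding of the integral. *)
Section LogDerivative.
Context {R : realType}.
Variable K : R -> R -> R.
Implicit Types (k x : R).
Hypothesis K_gt0 : forall k x, 0 < x -> 0 < K k x.
Hypothesis K_le_order : forall k l x, 0 < x -> `|k| <= `|l| -> K k x <= K l x.
Hypothesis K_decay : forall k x, 1 <= x -> K k x <= expR (1 - x) * K k 1.
Hypothesis K_recurrence : forall k x, 0 < x ->
  x * (K (k + 1) x - K (k - 1) x) = 2 * k * K k x.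
Hypothesis is_derive_K_mean : forall k x, 0 < x ->
  is_derive x 1 (K k) (- ((K (k + 1) x + K (k - 1) x) / 2)).

Lemma is_derive_K k x : 0 < x ->
  is_derive x 1 (K k) (- K (k + 1) x + k / x * K k x).
Proof.
move=> x0; apply: is_derive_eq; first exact: is_derive_K_mean.
have -> : k / x * K k x = 2 * k * K k x / (2 * x) by field; rewrite gt_eqF.
by rewrite -K_recurrence //; field; rewrite gt_eqF.
Qed.

Lemma K_sqr_bounded k : exists2 C : R, 0 <= C &
  forall x, 1 <= x -> K k x * x ^+ 2 <= C.
Proof.
have K1 := K_gt0 k (@ltr01 R).
exists (2 * expR 1 * K k 1); first by rewrite !mulr_ge0 ?expR_ge0 ?ler0n // ltW.
move=> x x1; have x0 : 0 <= x by lra.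
have e : x ^+ 2 * expR (- x) <= 2.
  rewrite expRN ler_pdivrMr ?expR_gt0 //.
  by have := @expR_ge1Dxn R x 1 x0; rewrite (_ : 2`! = 2)%N //; lra.
have := K_decay k x1; rewrite expRD => h.
apply: (@le_trans _ _ (expR 1 * expR (- x) * K k 1 * x ^+ 2)).
  by rewrite ler_wpM2r ?sqr_ge0.
have -> : expR 1 * expR (- x) * K k 1 * x ^+ 2
  = x ^+ 2 * expR (- x) * (expR 1 * K k 1) by ring.
rewrite -(mulrA 2) ler_wpM2r // mulr_ge0 ?expR_ge0 // ltW //.
Qed.

(** Each factor K is at most a multiple of x^(-2), so the product of two of
    them absorbs quadratic growth and still leaves a decay of order x^(-2). *)
Lemma K_mul_vanishing [k l C : R] [g f : R -> R] :
  (forall x, 1 <= x -> f x = K k x * K l x * g x) ->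
  (forall x, 1 <= x -> `|g x| <= C * x ^+ 2) -> vanishing f.
Proof.
move=> fE hg; have [C1 C10 h1] := K_sqr_bounded k.
have [C2 C20 h2] := K_sqr_bounded l.
exists (C1 * C2 * C) => x x1; have x0 : 0 < x by lra.
have Kk := K_gt0 k x0; have Kl := K_gt0 l x0.
have C0 : 0 <= C.
  have := hg 1 (lexx 1); rewrite expr1n mulr1; exact: le_trans.
rewrite fE // 2!normrM (gtr0_norm Kk) (gtr0_norm Kl).
have x20 : 0 < x ^+ 2 by rewrite exprn_gt0.
have b : K k x * K l x * `|g x| <= K k x * K l x * (C * x ^+ 2).
  by rewrite ler_wpM2l ?hg // mulr_ge0 // ltW.
apply: (le_trans b); rewrite ler_pdivlMr //.
apply: (@le_trans _ _ ((K k x * x ^+ 2) * (K l x * x ^+ 2) * C)); last first.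
  by rewrite ler_wpM2r // ler_pM ?h1 ?h2 // mulr_ge0 // ltW.
have -> : K k x * K l x * (C * x ^+ 2) * x
  = K k x * K l x * (C * (x ^+ 2 * x)) by ring.
have -> : K k x * x ^+ 2 * (K l x * x ^+ 2) * C
  = K k x * K l x * (C * (x ^+ 2 * x ^+ 2)) by ring.
rewrite ler_wpM2l ?mulr_ge0 ?(ltW Kk) ?(ltW Kl) //.
by rewrite ler_wpM2l // ler_wpM2l ?(ltW x20) // expr2; nra.
Qed.

(** [logK k] is - x K_k' / K_k, see [is_derive_K_log]. *)
Definition logK (k x : R) : R := x * K (k + 1) x / K k x - k.
(** The right-hand side of the Riccati equation of [logK k]. *)
Definition slopeK (k x : R) : R := logK k x ^+ 2 - x ^+ 2 - k ^+ 2.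

Lemma ratioKE k x : 0 < x -> K (k + 1) x / K k x = (k + logK k x) / x.
Proof.
move=> x0; rewrite /logK; field.
by rewrite !gt_eqF ?K_gt0.
Qed.

Lemma logK_succ k x : 0 < x -> x * K (k + 1) x = (logK k x + k) * K k x.
Proof. by move=> x0; rewrite /logK; field; rewrite gt_eqF ?K_gt0. Qed.

Lemma logK_pred k x : 0 < x -> x * K (k - 1) x = (logK k x - k) * K k x.
Proof.
move=> x0; have := K_recurrence k x0; have := logK_succ k x0.
lra.
Qed.

Lemma is_derive_K_log k x : 0 < x ->
  is_derive x 1 (K k) (- logK k x * K k x / x).
Proof.
move=> x0; apply: is_derive_eq; first exact: is_derive_K.
rewrite /logK; field.
by rewrite !gt_eqF ?K_gt0.
Qed.

Lemma is_derive_K_succ k x : 0 < x ->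
  is_derive x 1 (K (k + 1)) (- K k x - (k + 1) / x * K (k + 1) x).
Proof.
move=> x0; apply: is_derive_eq; first exact: is_derive_K_mean.
have := K_recurrence (k + 1) x0; rewrite addrK => e.
have -> : (k + 1) / x * K (k + 1) x = 2 * (k + 1) * K (k + 1) x / (2 * x).
  by field; rewrite gt_eqF.
by rewrite -e; field; rewrite gt_eqF.
Qed.

(** The Turan inequality: x^2 (K_(k+1) K_(k-1) - K_k^2) has derivative
    - 2 x K_k^2 and tends to 0 at infinity.  It is the positivity of
    [slopeK], in other words the monotonicity of [logK]. *)
Lemma K_turan k x : 0 < x ->
  K k x ^+ 2 < K (k + 1) x * K (k - 1) x.
Proof.
move=> x0; rewrite -subr_gt0.
pose f z := z ^+ 2 * (K (k + 1) z * K (k - 1) z - K k z ^+ 2).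
suff : 0 < f x by rewrite /f pmulr_rgt0 // exprn_gt0.
apply: (@decreasing_vanishing_gt0 _ f (fun z => - 2 * z * K k z ^+ 2)).
- move=> z xz; have z0 : 0 < z by lra.
  have h0 := is_derive_K k z0.
  have h1 := is_derive_K_succ k z0.
  have h2 := is_derive_K (k - 1) z0; rewrite subrK in h2.
  have e : K (k - 1) z = K (k + 1) z - 2 * k / z * K k z.
    have -> : 2 * k / z * K k z = (2 * k * K k z) / z by ring.
    by rewrite -K_recurrence //; field; rewrite gt_eqF.
  by rewrite /f; derive; rewrite e; field; rewrite gt_eqF.
- move=> z xz; have z0 : 0 < z by lra.
  by rewrite 2!mulNr oppr_lt0 mulr_gt0 ?exprn_gt0 ?K_gt0 // mulr_gt0.
have v1 : vanishing (fun z : R => K (k + 1) z * K (k - 1) z * z ^+ 2).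
  apply: (@K_mul_vanishing (k + 1) (k - 1) 1 (fun z => z ^+ 2)) => // z _.
  by rewrite mul1r ger0_norm // sqr_ge0.
have v2 : vanishing (fun z : R => K k z * K k z * z ^+ 2).
  apply: (@K_mul_vanishing k k 1 (fun z => z ^+ 2)) => // z _.
  by rewrite mul1r ger0_norm // sqr_ge0.
have [C1 h1] := v1; have [C2 h2] := v2; exists (C1 + C2) => z z1.
have -> : f z = K (k + 1) z * K (k - 1) z * z ^+ 2 - K k z * K k z * z ^+ 2.
  by rewrite /f; ring.
by rewrite mulrDl; apply: le_trans (ler_normB _ _) _; apply: lerD; [exact: h1|exact: h2].
Qed.

Lemma slopeK_gt0 k x : 0 < x -> 0 < slopeK k x.
Proof.
move=> x0; have K0 := K_gt0 k x0.
suff : 0 < slopeK k x * K k x ^+ 2 by rewrite pmulr_lgt0 // exprn_gt0.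
have -> : slopeK k x * K k x ^+ 2
    = (x * K (k + 1) x) * (x * K (k - 1) x) - x ^+ 2 * K k x ^+ 2.
  by rewrite logK_succ // logK_pred // /slopeK; ring.
rewrite mulrACA -expr2 -mulrBr mulr_gt0 ?exprn_gt0 // subr_gt0.
exact: K_turan.
Qed.

Lemma logK_gt0 k x : 0 < x -> 0 < logK k x.
Proof.
move=> x0; have K0 := K_gt0 k x0.
rewrite -(pmulr_lgt0 _ K0).
have := logK_succ k x0; have := logK_pred k x0.
have := mulr_gt0 x0 (K_gt0 (k + 1) x0); have := mulr_gt0 x0 (K_gt0 (k - 1) x0).
lra.
Qed.

Lemma logK_gt_norm k x : 0 < x -> `|k| < logK k x.
Proof.
move=> x0; have := slopeK_gt0 k x0; have y0 := logK_gt0 k x0; rewrite /slopeK => h.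
rewrite -(@ltr_pXn2r _ 2) ?nnegrE ?(ltW y0) // real_normK ?num_real //.
by have := sqr_ge0 x; lra.
Qed.

Lemma logK_gt k x : 0 < x -> k < logK k x.
Proof. by move=> x0; apply: le_lt_trans (logK_gt_norm k x0); exact: ler_norm. Qed.

Lemma logK_gt_arg k x : 0 < x -> x < logK k x.
Proof.
move=> x0; have := slopeK_gt0 k x0; have y0 := logK_gt0 k x0; rewrite /slopeK => h.
rewrite -(@ltr_pXn2r _ 2) ?nnegrE ?(ltW y0) ?(ltW x0) //.
by have := sqr_ge0 k; lra.
Qed.

Lemma is_derive_logK k x : 0 < x -> is_derive x 1 (logK k) (slopeK k x / x).
Proof.
move=> x0; have K0 := K_gt0 k x0.
have h0 := is_derive_K_log k x0; have h1 := is_derive_K_succ k x0.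
rewrite /logK; derive; first by rewrite gt_eqF.
have := logK_succ k x0.
set A := K (k + 1) x; set y := logK k x; set c := K k x => e.
have -> : A = (y + k) * c / x by rewrite -e; field; rewrite gt_eqF.
rewrite /slopeK -/y; field.
by rewrite !gt_eqF.
Qed.

Lemma logK_lt k x1 x2 : 0 < x1 -> x1 < x2 -> logK k x1 < logK k x2.
Proof.
move=> x0 x12; apply: (@derive_gt0_lt _ (logK k) (fun z => slopeK k z / z)) => // z /andP[z1 z2].
  by apply: is_derive_logK; lra.
by rewrite divr_gt0 ?slopeK_gt0 //; lra.
Qed.

Lemma logK_le_add k x : 2^-1 <= k -> 0 < x -> logK k x <= k + x.
Proof.
move=> k2 x0; have K0 := K_gt0 k x0.
rewrite -lerBlDl -(ler_pM2r K0) -logK_pred // ler_pM2l //.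
apply: K_le_order => //; rewrite (@ger0_norm _ k) ?ler_norml; lra.
Qed.

Lemma logK_mul_pred k x : 0 < x -> (logK k x - k) * (logK (k - 1) x + (k - 1)) = x ^+ 2.
Proof.
move=> x0; have K0 := K_gt0 k x0; have K1 := K_gt0 (k - 1) x0.
have n0 : K k x != 0 by rewrite gt_eqF.
have n1 : K (k - 1) x != 0 by rewrite gt_eqF.
apply: (mulIf (mulf_neq0 n0 n1)).
have := logK_succ (k - 1) x0; rewrite subrK => e.
rewrite mulrACA -logK_pred // -e; ring.
Qed.

(** The limit at 0 is |k|, which is also a lower bound.  If [logK k] stayed
    above |k| + e, its derivative would be at least a multiple of 1 / x near
    0, and a logarithmic divergence would make it negative. *)
Lemma logK_near0 k e : 0 < e ->
  exists2 d : R, 0 < d & forall x, 0 < x -> x < d -> logK k x < `|k| + e.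
Proof.
move=> e0.
suff [d d0 hd] : exists2 d : R, 0 < d & logK k d < `|k| + e.
  by exists d => // x x0 xd; apply: lt_trans hd; exact: logK_lt.
apply: contrapT => hn.
have hy x : 0 < x -> `|k| + e <= logK k x.
  by move=> x0; rewrite leNgt; apply/negP => h; apply: hn; exists x.
pose d := e ^+ 2 / 2; have d0 : 0 < d by rewrite divr_gt0 // exprn_gt0.
pose x1 := e / 2; have x10 : 0 < x1 by rewrite divr_gt0.
have hs x : 0 < x -> x <= x1 -> d <= slopeK k x.
  move=> x0 xx; have h := hy x x0; rewrite /slopeK /d.
  have a0 := normr_ge0 k.
  have -> : k ^+ 2 = `|k| ^+ 2 by rewrite real_normK ?num_real.
  have h2 : (`|k| + e) ^+ 2 <= logK k x ^+ 2 by rewrite ler_sqr ?nnegrE; lra.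
  have h3 : x ^+ 2 <= (e / 2) ^+ 2 by rewrite ler_sqr ?nnegrE /x1 in xx *; lra.
  have h4 : 0 <= `|k| * e by rewrite mulr_ge0 // ltW.
  have h5 : 0 <= e ^+ 2 by rewrite sqr_ge0.
  rewrite !expr2 in h2 h3 h5 *; lra.
pose g (z : R) := logK k z - d * ln z.
(* From x1 down to this point the logarithm drops by [logK k x1 / d]. *)
pose x := x1 * expR (- (logK k x1 / d)).
have y1 := logK_gt0 k x10.
have x0 : 0 < x by rewrite mulr_gt0 ?expR_gt0.
have xx1 : x <= x1.
  by rewrite -[leRHS]mulr1 ler_pM2l // expR_le1 oppr_le0 divr_ge0 // ltW.
have : g x <= g x1.
  apply: (@derive_ge0_le _ g (fun z => (slopeK k z - d) / z)) => // z /andP[xz zx].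
    have z0 : 0 < z by lra.
    have h1 := is_derive_logK k z0; have h2 := is_derive1_ln z0.
    by rewrite /g; derive; field; rewrite gt_eqF.
  by rewrite divr_ge0 ?subr_ge0 ?hs //; lra.
rewrite /g {2}/x lnM ?posrE ?expR_gt0 // expRK.
have -> : d * (ln x1 + - (logK k x1 / d)) = d * ln x1 - logK k x1.
  by field; rewrite gt_eqF.
have := logK_gt0 k x0; lra.
Qed.

(** * The level function and its slope *)
Section FixedOrder.
Variable nu : R.
Hypothesis nu_gt : 2^-1 < nu.
Implicit Types (l : R).

(** The quantities w, F, G, the weight and N of the introduction, in this
    order. *)
Definition shiftK l x : R := logK nu x - 2^-1 - l.
Definition levelK l x : R := shiftK l x ^+ 2 - x ^+ 2.
Definition levelslopeK l x : R := shiftK l x * slopeK nu x - x ^+ 2.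
Definition weightK l x : R := K nu x ^+ 2 * x `^ (2 * l - 1) / (1 + shiftK l x).
Definition turnK l x : R :=
  nu ^+ 2 - (2^-1 + l) ^+ 2 + 2 * l - 2 * l * (1 + shiftK l x) ^+ 2.
(** The closed range of lambda, on which w is positive; both end points are
    needed for the limits. *)
Definition admissible l := [/\ 0 <= l, l <= 2^-1 & l <= nu - 2^-1].

Lemma shiftK_gt l x : 0 < x -> nu - 2^-1 - l < shiftK l x.
Proof. by move=> x0; have := logK_gt nu x0; rewrite /shiftK; lra. Qed.

Lemma shiftK_gt0 l x : admissible l -> 0 < x -> 0 < shiftK l x.
Proof. by move=> [_ _ l3] x0; have := shiftK_gt l x0; lra. Qed.

Lemma shiftK_lt l x1 x2 : 0 < x1 -> x1 < x2 -> shiftK l x1 < shiftK l x2.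
Proof. by move=> x0 xx; have := logK_lt nu x0 xx; rewrite /shiftK; lra. Qed.

Lemma weightK_gt0 l x : admissible l -> 0 < x -> 0 < weightK l x.
Proof.
move=> al x0; have w0 := shiftK_gt0 al x0.
by rewrite divr_gt0 ?mulr_gt0 ?exprn_gt0 ?K_gt0 ?powR_gt0 //; lra.
Qed.

Lemma is_derive_shiftK l x : 0 < x -> is_derive x 1 (shiftK l) (slopeK nu x / x).
Proof. by move=> x0; have h := is_derive_logK nu x0; rewrite /shiftK; derive; ring. Qed.

Lemma is_derive_slopeK x : 0 < x ->
  is_derive x 1 (slopeK nu) ((2 * logK nu x * slopeK nu x - 2 * x ^+ 2) / x).
Proof.
move=> x0; have h := is_derive_logK nu x0; have hx := is_derive_var x.
by rewrite {1}/slopeK; derive; field; rewrite gt_eqF.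
Qed.

Lemma is_derive_levelK l x : 0 < x ->
  is_derive x 1 (levelK l) (2 * levelslopeK l x / x).
Proof.
move=> x0; have h := is_derive_shiftK l x0; have hx := is_derive_var x.
by rewrite /levelK; derive; rewrite /levelslopeK; field; rewrite gt_eqF.
Qed.

(** The exponent 2 l - 1 is chosen so that the logarithmic derivative of this
    weight is - 2 (1 + w) / x.  This makes it an integrating factor for
    E = G / (1 + w), which satisfies x E' = 2 (1 + w) E + terms without E,
    because E is F minus a function of w alone. *)
Let is_derive_besselweight l x : 0 < x -> is_derive x 1
  (fun z => K nu z ^+ 2 * z `^ (2 * l - 1))
  (- 2 * (1 + shiftK l x) / x * (K nu x ^+ 2 * x `^ (2 * l - 1))).
Proof.
move=> x0; have h1 := is_derive_K_log nu x0.
have h2 := is_derive_powR (2 * l - 1) x0.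
by derive; rewrite /shiftK; field; rewrite gt_eqF.
Qed.

(** The key computation: all terms carrying G cancel, and the sign of the
    derivative depends on N only. *)
Lemma is_derive_weighted l x : admissible l -> 0 < x ->
  is_derive x 1 (fun z => weightK l z * levelslopeK l z)
  (- (K nu x ^+ 2 * x `^ (2 * l - 1) * slopeK nu x / (1 + shiftK l x) ^+ 2 / x * turnK l x)).
Proof.
move=> al x0; have w0 := shiftK_gt0 al x0.
have h0 := is_derive_besselweight l x0; have h1 := is_derive_shiftK l x0.
have h2 := is_derive_slopeK x0; have hx := is_derive_var x.
rewrite /weightK /levelslopeK; derive; first by apply/eqP; lra.
rewrite /turnK; set m := K nu x ^+ 2 * x `^ (2 * l - 1).
rewrite /slopeK.
have -> : logK nu x = shiftK l x + 2^-1 + l by rewrite /shiftK; ring.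
set w := shiftK l x.
field.
by rewrite !gt_eqF //; rewrite /w; lra.
Qed.

Lemma logK_le_mul x : 1 <= x -> logK nu x <= (nu + 1) * x.
Proof.
move=> x1; have x0 : 0 < x by lra.
have : 0 <= nu * (x - 1) by rewrite mulr_ge0 ?subr_ge0 //; have := nu_gt; lra.
have := logK_le_add (ltW nu_gt) x0; lra.
Qed.

Lemma K_weighted_vanishing l [C : R] [g : R -> R] : admissible l ->
  (forall x, 1 <= x -> `|g x| <= C * x ^+ 2) ->
  vanishing (fun x => K nu x ^+ 2 * x `^ (2 * l - 1) * g x).
Proof.
move=> [_ l2 _] hg.
apply: (@K_mul_vanishing nu nu C (fun x => x `^ (2 * l - 1) * g x)) => x x1.
  by rewrite expr2 !mulrA.
have p1 : x `^ (2 * l - 1) <= 1.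
  have e : 2 * l - 1 <= 0 by lra.
  by have := ler_powR x1 e; rewrite powRr0.
rewrite normrM ger0_norm ?powR_ge0 //.
apply: le_trans (hg x x1); rewrite -[leRHS]mul1r ler_wpM2r //.
Qed.

(** As w / (1 + w) and 1 / (1 + w) are at most 1, G / (1 + w) is at most
    P + x^2 in absolute value, and P <= y^2 grows quadratically. *)
Lemma weighted_vanishing l : admissible l ->
  vanishing (fun x => weightK l x * levelslopeK l x).
Proof.
move=> al.
have [C hC] : vanishing (fun x => K nu x ^+ 2 * x `^ (2 * l - 1)
     * (levelslopeK l x / (1 + shiftK l x))).
  apply: (@K_weighted_vanishing l ((nu + 1) ^+ 2 + 1)) => // x x1.
  have x0 : 0 < x by lra.
  have w0 := shiftK_gt0 al x0; have P0 := slopeK_gt0 nu x0.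
  have x20 : 0 <= x ^+ 2 by rewrite sqr_ge0.
  have P2 : slopeK nu x <= (nu + 1) ^+ 2 * x ^+ 2.
    rewrite -exprMn /slopeK; have := sqr_ge0 nu.
    have : logK nu x ^+ 2 <= ((nu + 1) * x) ^+ 2.
      rewrite ler_sqr ?nnegrE ?logK_le_mul //; first exact/ltW/logK_gt0.
      by rewrite mulr_ge0 // ?(ltW x0) //; have := nu_gt; lra.
    lra.
  rewrite normrM normfV (@gtr0_norm _ (1 + _)) ?ler_pdivrMr; [|lra|lra].
  rewrite /levelslopeK; apply: le_trans (ler_normB _ _) _.
  rewrite (ger0_norm x20) gtr0_norm ?mulr_gt0 //.
  set w := shiftK l x in w0 *; set p := slopeK nu x in P0 P2 *.
  have : w * p <= w * ((nu + 1) ^+ 2 * x ^+ 2) by rewrite ler_wpM2l // ltW.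
  have : 0 <= w * x ^+ 2 by rewrite mulr_ge0 // ltW.
  have : 0 <= (nu + 1) ^+ 2 * x ^+ 2 by rewrite mulr_ge0 // sqr_ge0.
  set q := x ^+ 2; set r := (nu + 1) ^+ 2.
  lra.
exists C => x x1; have := hC x x1; rewrite /weightK.
by rewrite -!mulrA (mulrC (levelslopeK l x)).
Qed.

Lemma turnK_lt l x1 x2 : admissible l -> 0 < l -> 0 < x1 -> x1 < x2 ->
  turnK l x2 < turnK l x1.
Proof.
move=> al l0 x0 xx; have w1 := shiftK_gt0 al x0; have w12 := shiftK_lt l x0 xx.
rewrite /turnK ltrD2l ltrN2 ltr_pM2l; last by lra.
by rewrite ltr_sqr ?nnegrE; lra.
Qed.

Let weight_turn_gt0 l x : admissible l -> 0 < x ->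
  0 < K nu x ^+ 2 * x `^ (2 * l - 1) * slopeK nu x / (1 + shiftK l x) ^+ 2 / x.
Proof.
move=> al x0; have w0 := shiftK_gt0 al x0.
rewrite divr_gt0 // divr_gt0 ?exprn_gt0 //; last lra.
by rewrite !mulr_gt0 ?powR_gt0 ?slopeK_gt0 ?exprn_gt0 ?K_gt0.
Qed.

(** Once N is nonpositive it stays negative, so the weighted G increases to
    its limit 0 and is negative. *)
Lemma levelslopeK_lt0_of_turn l x : admissible l -> 0 < l -> 0 < x ->
  turnK l x <= 0 -> levelslopeK l x < 0.
Proof.
move=> al l0 x0 Nx; rewrite -(pmulr_rlt0 _ (weightK_gt0 al x0)).
apply: (@increasing_vanishing_lt0 _ (fun z => weightK l z * levelslopeK l z) _ x
  (fun z xz => is_derive_weighted al (lt_le_trans x0 xz))) (weighted_vanishing al) => z xz.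
have z0 : 0 < z by lra.
rewrite oppr_gt0 pmulr_rlt0 ?weight_turn_gt0 //.
by apply: lt_le_trans (turnK_lt al l0 x0 xz) Nx.
Qed.

(** Either N is nonpositive at the right point and the previous lemma applies,
    or N is positive on the whole interval and the weighted G decreases. *)
Lemma levelslopeK_no_return l x1 x2 : admissible l -> 0 < l -> 0 < x1 -> x1 < x2 ->
  levelslopeK l x1 <= 0 -> levelslopeK l x2 < 0.
Proof.
move=> al l0 x0 xx G1; have x20 : 0 < x2 by lra.
have [N2|N2] := leP (turnK l x2) 0; first exact: levelslopeK_lt0_of_turn.
rewrite -(pmulr_rlt0 _ (weightK_gt0 al x20)).
apply: (@lt_le_trans _ _ (weightK l x1 * levelslopeK l x1)); last first.
  by rewrite pmulr_rle0 // weightK_gt0.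
apply: (@derive_lt0_gt _ (fun z => weightK l z * levelslopeK l z) _ x1 x2 xx
  (fun z xz => is_derive_weighted al (lt_le_trans x0 (proj1 (andP xz))))) => z /andP[xz zx].
have z0 : 0 < z by lra.
by rewrite oppr_lt0 mulr_gt0 ?weight_turn_gt0 // (lt_trans N2) // turnK_lt.
Qed.

Lemma admissible0 : admissible 0.
Proof. by split; have := nu_gt; lra. Qed.

Lemma levelslopeK0_gt0 x : 0 < x -> 0 < levelslopeK 0 x.
Proof.
move=> x0; have al := admissible0; rewrite -(pmulr_rgt0 _ (weightK_gt0 al x0)).
apply: (@decreasing_vanishing_gt0 _ (fun z => weightK 0 z * levelslopeK 0 z) _ x
  (fun z xz => is_derive_weighted al (lt_le_trans x0 xz))) (weighted_vanishing al) => z xz.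
have z0 : 0 < z by lra.
rewrite oppr_lt0 mulr_gt0 ?weight_turn_gt0 // /turnK.
have -> : nu ^+ 2 - (2^-1 + 0) ^+ 2 + 2 * 0 - 2 * 0 * (1 + shiftK 0 z) ^+ 2
  = (nu - 2^-1) * (nu + 2^-1) by ring.
by rewrite mulr_gt0; have := nu_gt; lra.
Qed.

(** For l = 0 the equation for F is x F' = 2 (1 + w) (F - c) + 2 c with
    c = nu^2 - 1/4, so that F - c times the weight increases to 0. *)
Lemma levelK0_lt x : 0 < x -> levelK 0 x < nu ^+ 2 - 4^-1.
Proof.
move=> x0; have al := admissible0.
pose c := nu ^+ 2 - 4^-1.
have c0 : 0 < c.
  rewrite /c (_ : nu ^+ 2 - 4^-1 = (nu - 2^-1) * (nu + 2^-1)); last by field.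
  by rewrite mulr_gt0; have := nu_gt; lra.
have m0 z : 0 < z -> 0 < K nu z ^+ 2 * z `^ (2 * 0 - 1).
  by move=> z0; rewrite mulr_gt0 ?powR_gt0 ?exprn_gt0 // K_gt0.
rewrite -subr_lt0 -(pmulr_rlt0 _ (m0 _ x0)).
apply: (@increasing_vanishing_lt0 _
   (fun z => K nu z ^+ 2 * z `^ (2 * 0 - 1) * (levelK 0 z - c))
   (fun z => K nu z ^+ 2 * z `^ (2 * 0 - 1) * (2 * c) / z)).
- move=> z xz; have z0 : 0 < z by lra.
  have h1 := is_derive_besselweight 0 z0; have h2 := is_derive_levelK 0 z0.
  derive; rewrite /levelslopeK /levelK /slopeK /c.
  have -> : logK nu z = shiftK 0 z + 2^-1 by rewrite /shiftK; ring.
  by field; rewrite gt_eqF.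
- move=> z xz; have z0 : 0 < z by lra.
  by apply: divr_gt0 => //; apply: mulr_gt0; [exact: m0|lra].
apply: (@K_weighted_vanishing 0 ((nu + 1) ^+ 2 + 1 + c)) => // z z1.
have z0 : 0 < z by lra.
have w0 := shiftK_gt0 al z0; have z20 : 1 <= z ^+ 2 by rewrite exprn_ege1.
have w1 : shiftK 0 z ^+ 2 <= ((nu + 1) * z) ^+ 2.
  rewrite ler_sqr ?nnegrE ?(ltW w0) //.
    by have := logK_le_mul z1; rewrite /shiftK; lra.
  by rewrite mulr_ge0 // ?(ltW z0) //; have := nu_gt; lra.
have w2 : 0 <= shiftK 0 z ^+ 2 by rewrite sqr_ge0.
have n2 : 0 <= ((nu + 1) * z) ^+ 2 by rewrite sqr_ge0.
have cz : c <= c * z ^+ 2 by rewrite ler_peMr // ltW.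
by rewrite /levelK ler_norml 2!mulrDl mul1r -exprMn; lra.
Qed.

(** A rearrangement of G > 0. *)
Lemma levelK0_gt x : 0 < x ->
  (nu ^+ 2 - 4^-1) * (shiftK 0 x / (1 + shiftK 0 x)) < levelK 0 x.
Proof.
move=> x0; have w0 := shiftK_gt0 admissible0 x0.
rewrite mulrA ltr_pdivrMr; last lra.
have := levelslopeK0_gt0 x0; rewrite /levelslopeK /levelK /slopeK.
have -> : logK nu x = shiftK 0 x + 2^-1 by rewrite /shiftK; ring.
lra.
Qed.

(** At l = a the quantity N is negative everywhere: it is nu^2 - y^2 if
    a = 1/2, and 2 a (1 - (1 + w)^2) if a = nu - 1/2. *)
Lemma levelslopeK_lt0_max x : 0 < x -> levelslopeK (Num.min 2^-1 (nu - 2^-1)) x < 0.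
Proof.
move=> x0; set a := Num.min _ _.
have n2 := nu_gt.
have aE : a = 2^-1 /\ 2^-1 <= nu - 2^-1 \/ a = nu - 2^-1 /\ nu - 2^-1 <= 2^-1.
  by rewrite /a /Num.min; case: ltP => h; [left|right]; split => //; lra.
have al : admissible a by split; case: aE => -[-> ?]; lra.
have a0 : 0 < a by case: aE => -[-> ?]; lra.
apply: levelslopeK_lt0_of_turn => //.
have wx := shiftK_gt a x0; have ynu := logK_gt nu x0.
rewrite /turnK; case: aE => -[aE h]; rewrite aE in al a0 wx *.
  have -> : 1 + shiftK 2^-1 x = logK nu x by rewrite /shiftK; field.
  have : nu ^+ 2 <= logK nu x ^+ 2 by rewrite ler_sqr ?nnegrE; lra.
  lra.
have : 1 <= (1 + shiftK (nu - 2^-1) x) ^+ 2 by rewrite exprn_ege1 //; lra.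
rewrite expr2; nra.
Qed.

(** With phi = y - nu and psi the value of x K_nu / K_(nu-1), one has
    phi psi = x^2, hence
    G = phi ((s + phi) (2 nu + phi - psi) - psi) for s = nu - 1/2 - l.
    This is positive as soon as psi (1 + s) < 2 nu s, and psi tends to
    nu - 1 + |nu - 1|, which satisfies this bound because s > nu - 1. *)
Lemma levelslopeK_gt0_near0 l : 0 <= l -> l < 2^-1 -> l < nu - 2^-1 ->
  exists2 x : R, 0 < x & 0 < levelslopeK l x.
Proof.
move=> l0 l2 l3; set s := nu - 2^-1 - l.
have s0 : 0 < s by rewrite /s; lra.
have n2 := nu_gt.
(* [m] is the bound that psi has to stay below. *)
pose m := 2 * nu * s / (1 + s).
have m0 : nu - 1 + `|nu - 1| < m.
  rewrite /m ltr_pdivlMr; last lra.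
  have [n1|n1] := leP 1 nu.
    rewrite ger0_norm ?subr_ge0 //.
    have : nu - 1 < s by rewrite /s; lra.
    nra.
  by rewrite ltr0_norm ?subr_lt0 // subrr mul0r !mulr_gt0 //; lra.
have [d d0 hd] := @logK_near0 (nu - 1) (m - (nu - 1 + `|nu - 1|)) ltac:(by rewrite subr_gt0).
pose x := d / 2; have x0 : 0 < x by rewrite divr_gt0.
exists x => //.
have hx : logK (nu - 1) x + (nu - 1) < m.
  by have := hd x x0 ltac:(by rewrite /x; lra); lra.
have psi0 : 0 < logK (nu - 1) x + (nu - 1).
  by have := logK_gt_norm (nu - 1) x0; have := ler_norm (- (nu - 1)); rewrite normrN; lra.
have := logK_mul_pred nu x0; set psi := logK (nu - 1) x + (nu - 1) in hx psi0 *.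
set phi := logK nu x - nu => e.
have phi0 : 0 < phi by have := logK_gt nu x0; rewrite /phi; lra.
have hm : psi * (1 + s) < 2 * nu * s by move: hx; rewrite /m ltr_pdivlMr //; lra.
have yE : logK nu x = nu + phi by rewrite /phi; ring.
have wE : shiftK l x = s + phi by rewrite /shiftK yE /s; ring.
rewrite /levelslopeK wE /slopeK yE -e.
have -> : (s + phi) * ((nu + phi) ^+ 2 - phi * psi - nu ^+ 2) - phi * psi
  = phi * ((s + phi) * (2 * nu + phi - psi) - psi) by ring.
rewrite mulr_gt0 //.
have : 0 < 2 * nu - psi.
  rewrite subr_gt0 -(ltr_pM2r s0); apply: le_lt_trans hm; nra.
nra.
Qed.
(** * The contact point and the best constant *)
Let a := Num.min 2^-1 (nu - 2^-1).

Lemma maxshift_gt0 : 0 < a.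
Proof. by have := nu_gt; rewrite /a lt_min invr_gt0 ltr0n subr_gt0 => ->. Qed.

Lemma admissible_lt l : 0 < l -> l < a -> admissible l.
Proof. by move=> l0; rewrite /a lt_min => /andP[h1 h2]; split; exact: ltW. Qed.

Lemma levelslopeK_affine l1 l2 x :
  levelslopeK l2 x = levelslopeK l1 x - (l2 - l1) * slopeK nu x.
Proof. by rewrite /levelslopeK /shiftK; ring. Qed.

Lemma levelK_lt_shift l1 l2 x : admissible l2 -> l1 < l2 -> 0 < x ->
  levelK l2 x < levelK l1 x.
Proof.
move=> al l12 x0; have w2 := shiftK_gt0 al x0.
rewrite /levelK ltrD2r ltr_sqr ?nnegrE ?(ltW w2) //.
  by rewrite /shiftK; lra.
by move: w2; rewrite /shiftK; lra.
Qed.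

(** G is positive at some point, and negative where 2 l (1 + w)^2 exceeds
    nu^2 + 2 l; the point x2 is large enough for that since 1 + w > x2. *)
Lemma critical_point_exists l : 0 < l -> l < a ->
  exists x, 0 < x /\ levelslopeK l x = 0.
Proof.
move=> l0 la; have al := admissible_lt l0 la.
have [x1 x10 G1] : exists2 x : R, 0 < x & 0 < levelslopeK l x.
  move: la; rewrite /a lt_min => /andP[h1 h2].
  by apply: levelslopeK_gt0_near0 => //; exact: ltW.
pose x2 := (nu ^+ 2 + 2 * l) / (2 * l) + 1.
have q0 : 0 <= (nu ^+ 2 + 2 * l) / (2 * l).
  by apply: divr_ge0; have := sqr_ge0 nu; lra.
have x20 : 0 < x2 by rewrite /x2; lra.
have G2 : levelslopeK l x2 < 0.
  apply: levelslopeK_lt0_of_turn => //; rewrite /turnK.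
  have e : 2 * l * x2 = nu ^+ 2 + 4 * l.
    by rewrite /x2; field; rewrite gt_eqF.
  have wx : x2 < 1 + shiftK l x2.
    by have := logK_gt_arg nu x20; have [_ ? _] := al; rewrite /shiftK; lra.
  have h2 : x2 <= (1 + shiftK l x2) ^+ 2.
    have x21 : 1 <= x2 by rewrite /x2; lra.
    rewrite expr2; nra.
  have : 2 * l * x2 <= 2 * l * (1 + shiftK l x2) ^+ 2.
    by rewrite ler_wpM2l //; lra.
  have := sqr_ge0 (2^-1 + l); lra.
have x12 : x1 < x2.
  rewrite ltNge le_eqVlt; apply/negP => /predU1P[e|h].
    by rewrite e in G2; lra.
  by have := levelslopeK_no_return al l0 x20 h (ltW G2); lra.
have cG : {within `[x1, x2], continuous (levelslopeK l)}.
  apply: derivable_within_continuous => z; rewrite in_itv /= => /andP[z1 z2].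
  have z0 : 0 < z by lra.
  have h1 := is_derive_shiftK l z0; have h2 := is_derive_slopeK z0.
  have hz := is_derive_var z.
  have h : is_derive z 1 (levelslopeK l) (slopeK nu z / z * slopeK nu z +
     shiftK l z * ((2 * logK nu z * slopeK nu z - 2 * z ^+ 2) / z) - 2 * z).
    by rewrite /levelslopeK; derive; ring.
  by have [] := h.
have v0 : Num.min (levelslopeK l x1) (levelslopeK l x2) <= 0
    <= Num.max (levelslopeK l x1) (levelslopeK l x2).
  by rewrite ge_min le_max (ltW G2) (ltW G1) orbT.
have [c cx cG0] := IVT (ltW x12) cG v0.
by exists c; split => //; move: cx; rewrite in_itv /= => /andP[c1 _]; lra.
Qed.

Definition critK l : R := xget 0 [set x | 0 < x /\ levelslopeK l x = 0].
Definition bestK l : R := levelK l (critK l).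

Lemma critKP l : 0 < l -> l < a -> 0 < critK l /\ levelslopeK l (critK l) = 0.
Proof.
by move=> l0 la; exact: xgetPex (critical_point_exists l0 la).
Qed.

Lemma levelslopeK_lt0_after l x : 0 < l -> l < a -> critK l < x -> levelslopeK l x < 0.
Proof.
move=> l0 la cx; have [c0 G0] := critKP l0 la.
by apply: (levelslopeK_no_return (admissible_lt l0 la) l0 c0 cx); rewrite G0.
Qed.

Lemma levelslopeK_gt0_before l x : 0 < l -> l < a -> 0 < x -> x < critK l ->
  0 < levelslopeK l x.
Proof.
move=> l0 la x0 xc; have [c0 G0] := critKP l0 la.
rewrite ltNge; apply/negP => h.
by have := levelslopeK_no_return (admissible_lt l0 la) l0 x0 xc h; rewrite G0 ltxx.
Qed.

Lemma levelK_lt_best l x : 0 < l -> l < a -> 0 < x -> x != critK l ->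
  levelK l x < bestK l.
Proof.
move=> l0 la x0; have [c0 G0] := critKP l0 la; rewrite neq_lt => /orP[xc|cx].
  apply: (@derive_gt0_lt _ (levelK l) (fun z => 2 * levelslopeK l z / z)) => // z /andP[z1 z2].
    by apply: is_derive_levelK; lra.
  have z0 : 0 < z by lra.
  by rewrite divr_gt0 // mulr_gt0 // levelslopeK_gt0_before.
apply: (@derive_lt0_gt _ (levelK l) (fun z => 2 * levelslopeK l z / z)) => // z /andP[z1 z2].
  by apply: is_derive_levelK; lra.
have z0 : 0 < z by lra.
by rewrite pmulr_llt0 ?invr_gt0 // pmulr_rlt0 // levelslopeK_lt0_after.
Qed.

Lemma levelK_le_best l x : 0 < l -> l < a -> 0 < x -> levelK l x <= bestK l.
Proof.
move=> l0 la x0; have [->|xc] := eqVneq x (critK l); first by [].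
exact/ltW/levelK_lt_best.
Qed.

(** F exceeds (nu - 1/2 - l)^2 - x^2 at every x, and x is arbitrarily small. *)
Lemma bestK_ge l : 0 < l -> l < a -> (nu - 2^-1 - l) ^+ 2 <= bestK l.
Proof.
move=> l0 la; have al := admissible_lt l0 la.
rewrite leNgt; apply/negP => h.
set s := nu - 2^-1 - l in h.
have s0 : 0 <= s by rewrite /s; have [_ _] := al; lra.
pose e := s ^+ 2 - bestK l; have e0 : 0 < e by rewrite subr_gt0.
pose x := Num.min 1 e; have x0 : 0 < x by rewrite lt_min ltr01.
have x2 : x ^+ 2 <= e.
  have x1 : x <= 1 by rewrite ge_min lexx.
  have xe : x <= e by rewrite ge_min lexx orbT.
  by rewrite expr2; nra.
have := levelK_le_best l0 la x0; rewrite /levelK.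
have : s ^+ 2 < shiftK l x ^+ 2.
  rewrite ltr_sqr ?nnegrE //; first exact: shiftK_gt.
  exact/ltW/shiftK_gt0.
rewrite /e in x2; lra.
Qed.

Lemma bestK_gt0 l : 0 < l -> l < a -> 0 < bestK l.
Proof.
move=> l0 la; apply: lt_le_trans (bestK_ge l0 la).
by rewrite exprn_gt0 // subr_gt0; move: la; rewrite /a lt_min => /andP[_].
Qed.

Lemma bestK_lt l1 l2 : 0 < l1 -> l1 < l2 -> l2 < a -> bestK l2 < bestK l1.
Proof.
move=> l10 l12 l2a; have l20 : 0 < l2 by lra.
have l1a : l1 < a by lra.
have [c0 _] := critKP l20 l2a.
apply: (@lt_le_trans _ _ (levelK l1 (critK l2))); last exact: levelK_le_best.
exact: levelK_lt_shift (admissible_lt l20 l2a) l12 c0.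
Qed.

Lemma critK_lt l1 l2 : 0 < l1 -> l1 < l2 -> l2 < a -> critK l2 < critK l1.
Proof.
move=> l10 l12 l2a; have l20 : 0 < l2 by lra.
have l1a : l1 < a by lra.
have [c20 G2] := critKP l20 l2a; have [c10 G1] := critKP l10 l1a.
have h : levelslopeK l2 (critK l1) < 0.
  rewrite (levelslopeK_affine l1) G1 sub0r oppr_lt0.
  by apply: mulr_gt0; [rewrite subr_gt0|exact: slopeK_gt0].
rewrite ltNge le_eqVlt; apply/negP => /predU1P[e|e].
  by rewrite e G2 ltxx in h.
by have := levelslopeK_gt0_before l20 l2a c10 e; lra.
Qed.

Let ratio x := K (nu + 1) x / K nu x.

(** Turns the comparison of h and U into that of w and sqrt (b + x^2). *)
Lemma UKE b l x : 0 < x -> UK nu b l x - ratio x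
  = (Num.sqrt (b + x ^+ 2) - shiftK l x) / x.
Proof.
move=> x0; rewrite /ratio ratioKE // /UK /shiftK; field.
by rewrite gt_eqF.
Qed.

Lemma sqrt_levelK l x : admissible l -> 0 < x ->
  Num.sqrt (levelK l x + x ^+ 2) = shiftK l x.
Proof.
move=> al x0; rewrite /levelK subrK sqrtr_sqr ger0_norm //.
exact/ltW/shiftK_gt0.
Qed.

Lemma ratio_le_UK l x : 0 < l -> l < a -> 0 < x -> ratio x <= UK nu (bestK l) l x.
Proof.
move=> l0 la x0; rewrite -subr_ge0 UKE // divr_ge0 ?(ltW x0) // subr_ge0.
rewrite -(sqrt_levelK (admissible_lt l0 la) x0) ler_sqrt ?lerD2r ?levelK_le_best //.
by have := bestK_gt0 l0 la; have := sqr_ge0 x; lra.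
Qed.

Lemma ratio_eq_UK l x : 0 < l -> l < a -> 0 < x ->
  ratio x = UK nu (bestK l) l x <-> x = critK l.
Proof.
move=> l0 la x0; have al := admissible_lt l0 la; split => [e|->].
  apply/eqP/negPn/negP => /(levelK_lt_best l0 la x0) h.
  have : 0 < UK nu (bestK l) l x - ratio x.
    rewrite UKE // divr_gt0 // subr_gt0 -(sqrt_levelK al x0) ltr_sqrt ?ltrD2r //.
    by have := bestK_gt0 l0 la; have := sqr_ge0 x; lra.
  by rewrite e subrr ltxx.
have [c0 _] := critKP l0 la.
by apply/eqP; rewrite eq_sym -subr_eq0 UKE // /bestK sqrt_levelK // subrr mul0r.
Qed.

Lemma is_derive_ratio x : 0 < x ->
  is_derive x 1 ratio ((slopeK nu x - nu - logK nu x) / x ^+ 2).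
Proof.
move=> x0; have h0 := is_derive_K_log nu x0; have h1 := is_derive_K_succ nu x0.
have K0 := K_gt0 nu x0.
rewrite /ratio; derive; first by rewrite gt_eqF.
have := logK_succ nu x0; set A := K (nu + 1) x; set c := K nu x => e.
have -> : A = (logK nu x + nu) * c / x by rewrite -e; field; rewrite gt_eqF.
by rewrite /slopeK; field; rewrite !gt_eqF.
Qed.

Lemma is_derive_UK b l x : 0 < x -> 0 < b -> is_derive x 1 (UK nu b l)
  ((Num.sqrt (b + x ^+ 2))^-1 - (nu + 2^-1 + l + Num.sqrt (b + x ^+ 2)) / x ^+ 2).
Proof.
move=> x0 b0; have hx := is_derive_var x.
have p : 0 < b + x ^+ 2 by rewrite addr_gt0 // exprn_gt0.
have h : is_derive x 1 (fun z => b + z ^+ 2) (2 * x) by derive; ring.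
have hs : is_derive x 1 (fun z => Num.sqrt (b + z ^+ 2))
   ((2 * Num.sqrt (b + x ^+ 2))^-1 * (2 * x)) :=
   @is_derive1_comp _ Num.sqrt (fun z => b + z ^+ 2) _ _ _ (is_derive1_sqrt p) h.
rewrite /UK; derive; first by rewrite gt_eqF.
by field; rewrite !gt_eqF // sqrtr_gt0.
Qed.

(** At the contact point the square root equals w, and G = 0 reads
    1 / w = P / x^2, which is the equality of the two derivatives. *)
Lemma derive_contact l : 0 < l -> l < a ->
  [/\ derivable ratio (critK l) 1, derivable (UK nu (bestK l) l) (critK l) 1 &
   derive1 ratio (critK l) = derive1 (UK nu (bestK l) l) (critK l)].
Proof.
move=> l0 la; have [c0 G0] := critKP l0 la; have al := admissible_lt l0 la.
have h1 := is_derive_ratio c0; have h2 := is_derive_UK l c0 (bestK_gt0 l0 la).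
split; [by have [] := h1|by have [] := h2|].
rewrite !derive1E; have [_ ->] := h1; have [_ ->] := h2.
rewrite /bestK sqrt_levelK //; have w0 := shiftK_gt0 al c0.
have P0 := slopeK_gt0 nu c0.
have e : critK l ^+ 2 = shiftK l (critK l) * slopeK nu (critK l).
  by move: G0; rewrite /levelslopeK; lra.
have -> : logK nu (critK l) = shiftK l (critK l) + 2^-1 + l by rewrite /shiftK; ring.
by rewrite e; field; rewrite !gt_eqF.
Qed.
(** * Limits at the ends of the range of lambda *)
Let near0 (Q : R -> Prop) (d : R) : 0 < d ->
  (forall l, 0 < l -> l < d -> l < a -> Q l) -> \forall l \near 0^'+, Q l.
Proof.
move=> d0 h; near=> l; apply: h; near: l.
- exact: nbhs_right_gt.
- exact: nbhs_right_lt.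
- exact/nbhs_right_lt/maxshift_gt0.
Unshelve. all: end_near. Qed.

Let neara (Q : R -> Prop) (d : R) : 0 < d ->
  (forall l, 0 < l -> a - d < l -> l < a -> Q l) -> \forall l \near a^'-, Q l.
Proof.
move=> d0 h; near=> l; apply: h; near: l.
- exact/nbhs_left_gt/maxshift_gt0.
- by apply: nbhs_left_gt; rewrite ltrBlDr ltrDl.
- exact: nbhs_left_lt.
Unshelve. all: end_near. Qed.

Lemma bestK_lt_max l : 0 < l -> l < a -> bestK l < nu ^+ 2 - 4^-1.
Proof.
move=> l0 la; have [c0 _] := critKP l0 la.
apply: lt_trans (levelK0_lt c0).
exact: levelK_lt_shift (admissible_lt l0 la) l0 c0.
Qed.

(** The upper bound is [bestK_lt_max].  For the lower one, x is taken so large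
    that F exceeds c - e at l = 0; then it still does so for small l, and B is
    at least F. *)
Lemma bestK_cvg0 : bestK l @[l --> 0^'+] --> nu ^+ 2 - 4^-1.
Proof.
set c := nu ^+ 2 - 4^-1; apply/cvgrPdist_lt => e e0.
have c0 : 0 < c.
  rewrite /c (_ : nu ^+ 2 - 4^-1 = (nu - 2^-1) * (nu + 2^-1)); last by field.
  by rewrite mulr_gt0; have := nu_gt; lra.
(* The gap c - c w / (1 + w) is c / (1 + w), hence below e if 1 + w > c / e. *)
pose x := c / e + 1.
have x0 : 0 < x by rewrite addr_gt0 // divr_gt0.
have w0 : c / e < 1 + shiftK 0 x.
  by have := logK_gt_arg nu x0; rewrite /shiftK /x; lra.
have ce : 0 < c / e by rewrite divr_gt0.
have h0 : c - e < levelK 0 x.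
  apply: le_lt_trans (levelK0_gt x0).
  have -> : shiftK 0 x / (1 + shiftK 0 x) = 1 - (1 + shiftK 0 x)^-1.
    by field; apply/eqP; lra.
  rewrite mulrBr mulr1 lerD2l lerN2 ler_pdivrMr; last lra.
  by move: w0; rewrite ltr_pdivrMr // mulrC => /ltW.
have s0 : 0 < shiftK 0 x by exact: shiftK_gt0 admissible0 x0.
pose d := (levelK 0 x - (c - e)) / (2 * shiftK 0 x).
have d0 : 0 < d by rewrite divr_gt0 ?subr_gt0 // mulr_gt0.
apply: (near0 d0) => l l0 ld la.
have h1 := bestK_lt_max l0 la; have h2 := levelK_le_best l0 la x0.
have h3 : c - e < levelK l x.
  move: ld; rewrite /d ltr_pdivlMr ?mulr_gt0 // => ld.
  have : levelK l x = levelK 0 x - l * (2 * shiftK 0 x) + l ^+ 2.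
    by rewrite /levelK /shiftK; ring.
  by have := sqr_ge0 l; lra.
by rewrite gtr0_norm ?subr_gt0 //; rewrite -/c in h1 *; lra.
Qed.

(** At l = 0 the slope G is positive at any given x; it stays so for small
    l, which puts the contact point beyond x. *)
Lemma critK_cvg0 : critK l @[l --> 0^'+] --> +oo.
Proof.
apply/cvgryPge => A; pose x := Num.max A 1.
have x0 : 0 < x by rewrite lt_max ltr01 orbT.
have G0 := levelslopeK0_gt0 x0; have P0 := slopeK_gt0 nu x0.
have d0 : 0 < levelslopeK 0 x / slopeK nu x by rewrite divr_gt0.
apply: (near0 d0) => l l0 ld la.
have h : 0 < levelslopeK l x.
  rewrite (levelslopeK_affine 0) subr0 subr_gt0.
  by move: ld; rewrite ltr_pdivlMr.
apply: (@le_trans _ _ x); first by rewrite le_max lexx.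
rewrite leNgt; apply/negP => /(levelslopeK_lt0_after l0 la); lra.
Qed.

(** The mirror image of the previous argument: G is negative at e for l = a,
    hence for l close to a. *)
Lemma critK_near_max e : 0 < e -> exists2 d : R, 0 < d &
  forall l, 0 < l -> a - d < l -> l < a -> critK l < e.
Proof.
move=> e0; have Ga := levelslopeK_lt0_max e0; rewrite -/a in Ga.
have P0 := slopeK_gt0 nu e0.
exists (- levelslopeK a e / slopeK nu e); first by rewrite divr_gt0 // oppr_gt0.
move=> l l0; rewrite ltrBlDl -ltrBlDr ltr_pdivlMr // => ld la.
have h : levelslopeK l e < 0 by rewrite (levelslopeK_affine a); lra.
rewrite ltNge le_eqVlt; apply/negP => /predU1P[ec|ec].
  by have [_] := critKP l0 la; rewrite -ec => G0; rewrite G0 ltxx in h.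
by have := levelslopeK_gt0_before l0 la e0 ec; lra.
Qed.

Lemma critK_cvg_max : critK l @[l --> a^'-] --> (0 : R).
Proof.
apply/cvgrPdist_lt => e e0; have [d d0 hd] := critK_near_max e0.
apply: (neara d0) => l l0 ld la; have [c0 _] := critKP l0 la.
by rewrite sub0r normrN gtr0_norm // hd.
Qed.

Lemma logK_critK_cvg_max : logK nu (critK l) @[l --> a^'-] --> nu.
Proof.
apply/cvgrPdist_lt => e e0; have [r r0 hr] := logK_near0 nu e0.
have [d d0 hd] := critK_near_max r0.
apply: (neara d0) => l l0 ld la; have [c0 _] := critKP l0 la.
have h1 := logK_gt nu c0; have := hr _ c0 (hd l l0 ld la).
have n0 : 0 < nu by have := nu_gt; lra.
by rewrite gtr0_norm // distrC gtr0_norm ?subr_gt0 //; lra.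
Qed.

Lemma bestK_cvg_max : bestK l @[l --> a^'-] --> (nu - 2^-1 - a) ^+ 2.
Proof.
have idl : l @[l --> a^'-] --> a by apply: cvg_at_left_filter; exact: cvg_id.
have low : (nu - 2^-1 - l) ^+ 2 @[l --> a^'-] --> (nu - 2^-1 - a) ^+ 2.
  by rewrite !expr2; apply: cvgM; (apply: cvgB; [exact: cvg_cst|exact: idl]).
have upp : (logK nu (critK l) - 2^-1 - l) ^+ 2 @[l --> a^'-] --> (nu - 2^-1 - a) ^+ 2.
  have h : logK nu (critK l) - 2^-1 - l @[l --> a^'-] --> nu - 2^-1 - a.
    by apply: cvgB; [apply: cvgB; [exact: logK_critK_cvg_max|exact: cvg_cst]|exact: idl].
  by rewrite expr2; exact: (cvgM h h).
apply: (squeeze_cvgr _ low upp).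
apply: (neara ltr01) => l l0 _ la; rewrite bestK_ge //=.
by rewrite /bestK /levelK /shiftK lerBlDr lerDl sqr_ge0.
Qed.

Lemma max_shift_sqr : (nu - 2^-1 - a) ^+ 2 = Theta (nu - 1) * (nu - 1) ^+ 2.
Proof.
rewrite /Theta /a /Num.min subr_ge0; case: ltP => h; case: leP => h2; try (field; fail).
- rewrite mul1r; congr (_ ^+ 2); lra.
- lra.
- have -> : nu = 1 by lra.
  by field.
- by rewrite subrr expr0n mul0r.
Qed.

Theorem ratio_best_bounds :
  exists B xs : R -> R,
    (forall l : R, 0 < l -> l < a ->
      [/\ 0 < B l,
          (forall x : R, 0 < x -> ratio x <= UK nu (B l) l x),
          0 < xs l,
          (forall x : R, 0 < x -> (ratio x = UK nu (B l) l x <-> x = xs l)) &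
          [/\ derivable ratio (xs l) 1,
              derivable (UK nu (B l) l) (xs l) 1 &
              derive1 ratio (xs l) = derive1 (UK nu (B l) l) (xs l)]]) /\
    (forall l1 l2 : R, 0 < l1 -> l1 < l2 -> l2 < a -> B l2 < B l1) /\
    (forall l1 l2 : R, 0 < l1 -> l1 < l2 -> l2 < a -> xs l2 < xs l1) /\
    B l @[l --> 0^'+] --> nu ^+ 2 - 4^-1 /\
    B l @[l --> a^'-] --> Theta (nu - 1) * (nu - 1) ^+ 2 /\
    xs l @[l --> 0^'+] --> +oo /\
    xs l @[l --> a^'-] --> (0 : R).
Proof.
exists bestK, critK; split.
  move=> l l0 la; split.
  - exact: bestK_gt0.
  - by move=> x x0; exact: ratio_le_UK.
  - by have [] := critKP l0 la.
  - by move=> x x0; exact: ratio_eq_UK.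
  - exact: derive_contact.
split; first exact: bestK_lt.
split; first exact: critK_lt.
split; first exact: bestK_cvg0.
split; first by rewrite -max_shift_sqr; exact: bestK_cvg_max.
split; [exact: critK_cvg0|exact: critK_cvg_max].
Qed.

End FixedOrder.
End LogDerivative.

Theorem theorem11 (R : realType) (nu a : R) (hnu : 2^-1 < nu)
    (ha : a = Num.min 2^-1 (nu - 2^-1)) :
  exists B xs : R -> R,
    (forall lambda : R, 0 < lambda -> lambda < a ->
      [/\ 0 < B lambda,
          (forall x : R, 0 < x -> hK nu x <= UK nu (B lambda) lambda x),
          0 < xs lambda,
          (forall x : R, 0 < x ->
            (hK nu x = UK nu (B lambda) lambda x <-> x = xs lambda)) &
          [/\ derivable (hK nu) (xs lambda) 1,
              derivable (UK nu (B lambda) lambda) (xs lambda) 1 &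
              derive1 (hK nu) (xs lambda)
                = derive1 (UK nu (B lambda) lambda) (xs lambda)]]) /\
    (forall l1 l2 : R, 0 < l1 -> l1 < l2 -> l2 < a -> B l2 < B l1) /\
    (forall l1 l2 : R, 0 < l1 -> l1 < l2 -> l2 < a -> xs l2 < xs l1) /\
    B lambda @[lambda --> 0^'+] --> nu ^+ 2 - 4^-1 /\
    B lambda @[lambda --> a^'-] --> Theta (nu - 1) * (nu - 1) ^+ 2 /\
    xs lambda @[lambda --> 0^'+] --> +oo /\
    xs lambda @[lambda --> a^'-] --> (0 : R).
Proof.
rewrite ha.
exact: (@ratio_best_bounds R (@besselK R) (@besselK_gt0 R)
  (fun k l x => @besselK_le_order R k l x) (@besselK_decay R)
  (@besselK_recurrence R) (@is_derive_besselK_mean R) nu hnu).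
Qed.
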